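(* Let $G_1$ and $G_2$ be simple connected graphs, neither of which contains a well-connected vertex. Then the disjunction $G_1\vee G_2$ satisfies \[ C^\xi(G_1\vee G_2) = |E(G_1)|\,|V(G_2)|^2 + |E(G_2)|\,|V(G_1)|^2 - 2|E(G_1)|\,|E(G_2)| . \]
   Context: A vertex of a graph is well-connected if it is adjacent to all other vertices of the graph. The disjunction $G_1\vee G_2$ has vertex set $V(G_1)\times V(G_2)$, with $(u_1,u_2)$ adjacent to $(v_1,v_2)$ whenever $u_1$ is adjacent to $v_1$ in $G_1$ or $u_2$ is adjacent to $v_2$ in $G_2$. For a connected graph $H$, $d_H(v)$ is the degree of $v$, the eccentricity $\varepsilon_H(v)$ is the largest distance from $v$ to any other vertex, and the connective eccentric index is $C^\xi(H)=\sum_{v\in V(H)} \frac{d_H(v)}{\varepsilon_H(v)}$. *)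

(* Defs.v *)
From mathcomp Require Import all_boot all_order all_algebra.
Set Implicit Arguments.
Unset Strict Implicit.
Unset Printing Implicit Defensive.
Import Order.TTheory GRing.Theory Num.Theory.
Local Open Scope ring_scope.

Record sgraph := SGraph {
  vertex :> finType;
  adj : rel vertex;
  adj_sym : symmetric adj;
  adj_irrefl : irreflexive adj
}.

Section Graph.
Variable G : sgraph.
Implicit Types u v : G.

Definition edges : {set {set G}} :=
  [set [set p.1; p.2] | p : G * G & adj p.1 p.2].

Definition connected : Prop := forall u v, connect (@adj G) u v.

Definition well_connected u : bool := [forall v, (v != u) ==> adj u v].

Definition deg u : nat := #|[set v | adj u v]|.

Definition walk u v (n : nat) : bool :=
  [exists p : n.-tuple G, path (@adj G) u p && (last u p == v)].

(* Least length of a walk from u to v. A shortest walk repeats no vertex, so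
   searching the lengths below #|G| suffices; when v is not reachable from u
   the value is #|G|, outside the range of genuine distances. *)
Definition dist u v : nat := find (walk u v) (iota 0 #|G|).

Definition ecc u : nat := \max_(v | v != u) dist u v.

Definition connective_eccentric_index : rat :=
  \sum_(u : G) (deg u)%:R / (ecc u)%:R.

End Graph.

Section Disjunction.
Variables G1 G2 : sgraph.

Definition disj_adj : rel (G1 * G2) :=
  fun u v => adj u.1 v.1 || adj u.2 v.2.

Fact disj_adj_sym : symmetric disj_adj.
Proof.
by move=> u v; rewrite /disj_adj (adj_sym u.1) (adj_sym u.2).
Qed.

Fact disj_adj_irrefl : irreflexive disj_adj.
Proof. by move=> u; rewrite /disj_adj !adj_irrefl. Qed.

Definition disjunction : sgraph := SGraph disj_adj_sym disj_adj_irrefl.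

End Disjunction.

(* Main.v *)
(** Every vertex of the disjunction has eccentricity exactly 2. A vertex [v1] of
    [G1] that is neither [u1] nor adjacent to it makes [(v1, u2)] a vertex at
    distance at least 2 from [(u1, u2)]; conversely, neighbours [w1] of [u1] and
    [w2] of [v2] give the common neighbour [(w1, w2)] of [(u1, u2)] and
    [(v1, v2)]. The index is therefore half of the sum of the degrees
    [d1 n2 + d2 n1 - d1 d2], which the handshake lemma evaluates. *)

Require Import Defs.
From mathcomp Require Import all_boot all_order all_algebra.
From mathcomp Require Import ring.
Import GRing.Theory Num.Theory.
Local Open Scope ring_scope.

Section Graph.
Variable G : sgraph.
Implicit Types u v w : G.

Lemma adj_neq u v : adj u v -> u != v.
Proof. by apply: contraTneq => ->; rewrite adj_irrefl. Qed.

(** Both sides count ordered adjacent pairs: the map from [(a, b)] to the set of its endpoints has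
    fibres of size two over [edges G]. *)
Lemma handshake : (\sum_(u : G) deg u = 2 * #|edges G|)%N.
Proof.
have -> : (\sum_(u : G) deg u = \sum_(p : G * G | adj p.1 p.2) 1)%N.
  rewrite -(pair_big_dep predT (fun u v => adj u v) (fun _ _ => 1%N)) /=.
  by apply: eq_bigr => u _; rewrite sum1_card /deg cardsE.
rewrite (partition_big (fun p : G * G => [set p.1; p.2]) (fun e => e \in edges G)) /=;
  last by move=> p pE; apply: imset_f; rewrite inE.
rewrite mulnC -sum_nat_const; apply: eq_bigr => e /imsetP[[a b]].
rewrite inE /= => ab ->.
have neq_ab := adj_neq _ _ ab.
rewrite sum1_card.
(* The fibre over the edge is these two orientations, distinct because there are no loops. *)
have -> : 2%N = #|[set (a, b); (b, a)]|.
  by rewrite cards2 xpair_eqE (negPf neq_ab).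
apply: eq_card => -[x y]; rewrite !inE unfold_in /= !xpair_eqE.
apply/idP/idP.
- case/andP=> xy /eqP Exy; have := adj_neq _ _ xy.
  have : x \in [set a; b] by rewrite -Exy set21.
  have : y \in [set a; b] by rewrite -Exy set22.
  rewrite !inE => /orP[]/eqP-> /orP[]/eqP->; rewrite ?eqxx ?orbT //.
- case/orP=> /andP[/eqP-> /eqP->]; first by rewrite ab eqxx.
  by rewrite adj_sym ab setUC eqxx.
Qed.

Lemma non_neighbour u :
  ~~ well_connected u -> exists2 v, v != u & ~~ adj u v.
Proof.
by rewrite negb_forall => /existsP[v]; rewrite negb_imply => /andP[]; exists v.
Qed.

Lemma connected_neighbour u v :
  connected G -> v != u -> exists w, adj u w.
Proof.
move=> conn; case/connectP: (conn u v) => -[|w p] /=.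
  by move=> _ ->; rewrite eqxx.
by case/andP=> uw _ _ _; exists w.
Qed.

Lemma walk0 u v : walk u v 0 = (u == v).
Proof.
apply/existsP/idP => [[p]|uv]; first by rewrite (tuple0 p).
by exists [tuple].
Qed.

Lemma walk1 u v : walk u v 1 = adj u v.
Proof.
apply/existsP/idP => [[p]|uv].
  by case/tupleP: p => w p; rewrite (tuple0 p) /= andbT => /andP[uw /eqP<-].
by exists [tuple v]; rewrite /= uv eqxx.
Qed.

(** For [n] below [#|G|], the search stops at [n] at the latest; for larger [n], its default value
    [#|G|] already suffices. *)
Lemma dist_le_walk u v n : walk u v n -> (dist u v <= n)%N.
Proof.
move=> wn; rewrite leqNgt; apply/negP => lt_n.
have lt_nG : (n < #|G|)%N.
  by apply: leq_trans lt_n _; rewrite -[leqRHS](size_iota 0) find_size.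
by have := before_find 0 lt_n; rewrite nth_iota // add0n wn.
Qed.

Lemma dist_ge2 u v : v != u -> ~~ adj u v -> (2 <= dist u v)%N.
Proof.
move=> vu nadj.
(* Guarantees that lengths 0 and 1 are both searched, so that their failure forces the result up to
   2. *)
have : (2 <= #|G|)%N by have := max_card (pred2 v u); rewrite card2 vu.
rewrite /dist; case: #|G| => [|[|n]] //= _.
by rewrite walk0 walk1 eq_sym (negPf vu) (negPf nadj).
Qed.

Lemma common_neighbour_dist u v w : adj u w -> adj w v -> (dist u v <= 2)%N.
Proof.
move=> uw wv; apply: dist_le_walk; apply/existsP; exists [tuple w; v].
by rewrite /= uw wv eqxx.
Qed.

End Graph.

Section Disjunction.
Variables G1 G2 : sgraph.

(** Inclusion-exclusion: the neighbourhood is the union of [A] times [G2] and [G1] times [B], which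
    meet in [A] times [B]. *)
Lemma deg_disjunction (u : disjunction G1 G2) :
  (deg u)%:R = (deg u.1)%:R * #|G2|%:R + (deg u.2)%:R * #|G1|%:R
                 - (deg u.1)%:R * (deg u.2)%:R :> rat.
Proof.
(* Moving the product across leaves an identity without subtraction, which descends to [nat]. *)
apply/eqP; rewrite eq_sym subr_eq -!natrM -!natrD eqr_nat; apply/eqP.
pose A := [set v : G1 | adj u.1 v]; pose B := [set v : G2 | adj u.2 v].
have -> : deg u = #|setX A setT :|: setX setT B|.
  by apply: eq_card => v; rewrite !inE andbT.
have := cardsUI (setX A [set: G2]) (setX [set: G1] B).
have -> : setX A [set: G2] :&: setX [set: G1] B = setX A B.
  by apply/setP => v; rewrite !inE andbT.
by rewrite !cardsX !cardsT [(#|G1| * _)%N]mulnC => ->.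
Qed.

Hypotheses (conn1 : connected G1) (conn2 : connected G2).
Hypotheses (nwc1 : forall u : G1, ~~ well_connected u)
           (nwc2 : forall u : G2, ~~ well_connected u).

Lemma ecc_disjunction (u : disjunction G1 G2) : ecc u = 2%N.
Proof.
apply/eqP; rewrite eqn_leq; apply/andP; split.
  apply/bigmax_leqP => v _.
  (* [x] and [y] show that [u.1] and [v.2] are not alone in their graphs, so connectedness yields
     neighbours. *)
  have [x xu _] := non_neighbour _ _ (nwc1 u.1).
  have [y yv _] := non_neighbour _ _ (nwc2 v.2).
  have [w1 uw1] := connected_neighbour _ _ _ conn1 xu.
  have [w2 vw2] := connected_neighbour _ _ _ conn2 yv.
  apply: (@common_neighbour_dist _ u v ((w1, w2) : disjunction G1 G2)).
    by rewrite /= /disj_adj uw1.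
  by rewrite /= /disj_adj (adj_sym w2) vw2 orbT.
have [x xu nux] := non_neighbour _ _ (nwc1 u.1).
pose v : disjunction G1 G2 := (x, u.2).
have vu : v != u by apply: contraNneq xu => <-.
apply: leq_trans (@leq_bigmax_cond _ (fun w => w != u) (dist u) v vu).
apply: dist_ge2 => //.
by rewrite /= /disj_adj /= (negPf nux) adj_irrefl.
Qed.

End Disjunction.

Theorem theorem6 (G1 G2 : sgraph)
  (conn1 : connected G1) (conn2 : connected G2)
  (nwc1 : forall u : G1, ~~ well_connected u)
  (nwc2 : forall u : G2, ~~ well_connected u) :
  connective_eccentric_index (disjunction G1 G2) =
    #|edges G1|%:R * #|G2|%:R ^+ 2 + #|edges G2|%:R * #|G1|%:R ^+ 2
      - 2 * #|edges G1|%:R * #|edges G2|%:R.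
Proof.
have handshakeQ (G : sgraph) : \sum_(u : G) (deg u)%:R = 2 * #|edges G|%:R :> rat.
  by rewrite -natr_sum handshake natrM.
rewrite /connective_eccentric_index.
under eq_bigr => u _ do rewrite ecc_disjunction // deg_disjunction.
rewrite -mulr_suml.
rewrite -(pair_bigA _ (fun (i : G1) (j : G2) =>
  (deg i)%:R * #|G2|%:R + (deg j)%:R * #|G1|%:R - (deg i)%:R * (deg j)%:R)) /=.
(* With [i] fixed, summing over [j] turns the degrees in [G2] into twice its edge count; the outer
   sum then does the same for [G1]. *)
under eq_bigr => i _.
  rewrite sumrB big_split /= sumr_const -mulr_suml -mulr_sumr handshakeQ.
  rewrite -[_ *+ #|_|]mulr_natr; over.
rewrite sumrB big_split /= sumr_const -!mulr_suml handshakeQ.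
rewrite -[_ *+ #|_|]mulr_natr.
by field.
Qed.
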